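(* Let $m>0$, $0<k\leq 1$ and $0\leq\lambda<1$. Then the function $$\mathcal{F}(m,z)=z-\sum_{n=2}^{\infty}\frac{m^{n-1}}{(n-1)!}e^{-m}z^{n}$$ is in $\mathcal{C}(k,\lambda)$ if and only if $$\big((1-\lambda)+k(1+\lambda)\big)\,m^{2}e^{m}+2(1+2k+k\lambda-\lambda)\,me^{m}\leq 2k.$$
   Context: Let $\mathcal{U}=\{z\in\mathbb{C}:|z|<1\}$. Let $\mathcal{A}$ be the class of functions $f(z)=z+\sum_{n=2}^{\infty}a_nz^n$ analytic in $\mathcal{U}$, and let $\mathcal{T}$ be the subclass of $\mathcal{A}$ of functions of the form $f(z)=z-\sum_{n=2}^{\infty}|a_n|z^n$, $z\in\mathcal{U}$. For $0<k\leq1$ and $0\leq\lambda<1$, a function $f$ of the form $f(z)=z-\sum_{n=2}^{\infty}|a_n|z^n$ (i.e. $f\in\mathcal{T}$) is in $\mathcal{S}(k,\lambda)$ if $$\left|\frac{\frac{zf'(z)}{(1-\lambda)f(z)+\lambda zf'(z)}-1}{\frac{zf'(z)}{(1-\lambda)f(z)+\lambda zf'(z)}+1}\right|<k\qquad (z\in\mathcal{U}),$$ and $f\in\mathcal{C}(k,\lambda)$ if and only if $zf'\in\mathcal{S}(k,\lambda)$. *)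

(* Defs.v *)
From Stdlib Require Import Reals.
From Coquelicot Require Import Coquelicot.

Open Scope R_scope.

Definition unit_disk (z : C) : Prop := Cmod z < 1.

(* Coefficients of [sum_(n >= 2) a n z^n]: the entries of index 0 and 1 are
   dropped. *)
Definition from2 (a : nat -> C) (n : nat) : C :=
  match n with
  | S (S _) => a n
  | _ => RtoC 0
  end.

Definition is_CPSeries (a : nat -> C) (z l : C) : Prop :=
  @is_pseries C_AbsRing C_NormedModule a z l.

(* Sum of a complex power series; it is only meaningful where the series
   converges (Coquelicot's [PSeries] is restricted to real arguments). *)
Definition CPSeries (a : nat -> C) (z : C) : C :=
  @iota C_CompleteNormedModule (is_CPSeries a z).

Definition analytic_on_disk (f : C -> C) : Prop :=
  forall z : C, unit_disk z -> @ex_derive C_AbsRing C_NormedModule f z.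

Definition class_A (f : C -> C) : Prop :=
  analytic_on_disk f /\
  exists a : nat -> C,
    forall z : C, unit_disk z -> is_CPSeries (from2 a) z (f z - z)%C.

Definition class_T (f : C -> C) : Prop :=
  class_A f /\
  exists a : nat -> C,
    forall z : C, unit_disk z ->
      is_CPSeries (from2 (fun n => RtoC (Cmod (a n)))) z (z - f z)%C.

(* [C_derive f z] is the complex derivative only where [f] is complex
   differentiable; below it is used on the disk for analytic [f]. *)
Definition zderiv (f : C -> C) (z : C) : C := (z * C_derive f z)%C.

Definition quot_denom (lambda : R) (f : C -> C) (z : C) : C :=
  ((1 - RtoC lambda) * f z + RtoC lambda * zderiv f z)%C.

(* [z f'(z) / ((1 - lambda) f(z) + lambda z f'(z))].  At [z = 0] numerator and
   denominator vanish; for [f(z) = z + ...] the singularity is removable, with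
   value 1. *)
Definition quot (lambda : R) (f : C -> C) (z : C) : C :=
  if Ceq_dec z (RtoC 0) then RtoC 1
  else (zderiv f z / quot_denom lambda f z)%C.

(* Division in [C] is total, so the conditions that the two denominators do not
   vanish are explicit. *)
Definition class_S (k lambda : R) (f : C -> C) : Prop :=
  class_T f /\
  forall z : C, unit_disk z ->
    (z <> RtoC 0 -> quot_denom lambda f z <> RtoC 0) /\
    (quot lambda f z + 1)%C <> RtoC 0 /\
    Cmod ((quot lambda f z - 1) / (quot lambda f z + 1))%C < k.

Definition class_C (k lambda : R) (f : C -> C) : Prop :=
  class_T f /\ class_S k lambda (zderiv f).

Definition poisson_F (m : R) (z : C) : C :=
  (z - CPSeries
         (from2 (fun n => RtoC (m ^ (n - 1) / INR (Factorial.fact (n - 1)) * exp (- m))))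
         z)%C.

(* Main.v *)
(** For [f z = z - sum c_n z^n] with [c_n >= 0], put [g = z f'] and let [d] be
    the denominator [(1 - lambda) f + lambda z f'].  The Moebius quotient in the
    definition of [class_S] is [(g - d) / (g + d)], where
    [g - d = - (1 - lambda) sum (n - 1) c_n z^n] and
    [g + d = 2 z - sum ((1 + lambda) n + 1 - lambda) c_n z^n].  By the triangle
    inequality the quotient is smaller than [k] as soon as
    [sum ((1 - lambda) (n - 1) + k ((1 + lambda) n + 1 - lambda)) c_n <= 2 k].
    Conversely, on [0 < z < 1] the real number [g + d] is positive near [0] and
    never vanishes, hence is positive, and letting [z] tend to [1] gives that
    inequality back.  For the coefficients of [z F'(m, z)] the sum is computed
    from the first two factorial moments of the Poisson distribution. *)

Require Import Defs.
From Stdlib Require Import Reals Ranalysis5 Lra Lia.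
From Coquelicot Require Import Coquelicot.

Open Scope R_scope.

(** * Complex power series: convergence and termwise differentiation *)

Lemma pow_n_Cpow (z : C) (n : nat) : @pow_n C_Ring z n = (z ^ n)%C.
Proof.
  induction n as [|n IH]; simpl; [reflexivity|].
  now rewrite IH.
Qed.

Lemma is_CPSeries_Cpow (a : nat -> C) (z l : C) :
  is_CPSeries a z l <->
  @is_series C_AbsRing C_NormedModule (fun n => (a n * z ^ n)%C) l.
Proof.
  assert (E : forall n, @scal C_AbsRing C_NormedModule (@pow_n C_AbsRing z n) (a n)
                        = (a n * z ^ n)%C).
  { intros n. rewrite pow_n_Cpow. apply Cmult_comm. }
  split; apply is_series_ext; intros n; now rewrite E.
Qed.

Lemma is_CPSeries_unique (a : nat -> C) (z l : C) :
  is_CPSeries a z l -> CPSeries a z = l.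
Proof.
  intros H. apply (@iota_unique C_AbsRing C_CompleteNormedModule (is_CPSeries a z)); [|exact H].
  intros y Hy.
  exact (@filterlim_locally_unique nat C_AbsRing C_NormedModule eventually _ _ _ _ Hy H).
Qed.

Lemma Series_nonneg (b : nat -> R) :
  (forall n, 0 <= b n) -> ex_series b -> 0 <= Series b.
Proof.
  intros Hb0 Hb.
  rewrite <- (Rmult_0_l (Series b)), <- Series_scal_l.
  apply Series_le; [|exact Hb]. intros n. specialize (Hb0 n). lra.
Qed.

(** The triangle inequality for partial sums, passed to the limit. *)
Lemma Cmod_is_series_le (a : nat -> C) (b : nat -> R) (l : C) :
  (forall n, Cmod (a n) <= b n) -> ex_series b ->
  @is_series C_AbsRing C_NormedModule a l -> Cmod l <= Series b.
Proof.
  intros Hab Hb Ha.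
  assert (Hn : is_lim_seq (fun n => Cmod (@sum_n C_NormedModule a n)) (Cmod l)).
  { unfold is_lim_seq.
    apply (filterlim_comp _ _ _ (@sum_n C_NormedModule a) Cmod _ (@locally C_NormedModule l)).
    - exact Ha.
    - exact (@filterlim_norm C_AbsRing C_NormedModule l). }
  assert (Hs : is_lim_seq (sum_n b) (Series b)) by exact (Series_correct _ Hb).
  refine (is_lim_seq_le _ _ _ _ _ Hn Hs).
  intros n. unfold sum_n.
  refine (Rle_trans _ _ _ (@norm_sum_n_m C_AbsRing C_NormedModule a 0 n) _).
  apply sum_n_m_le. exact Hab.
Qed.

(** The moduli form a real power series that converges at [Cmod z] and dominates the complex one;
    real radii of convergence thus control complex arguments. *)
Lemma CPSeries_correct (a : nat -> C) (z : C) :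
  Rbar_lt (Cmod z) (CV_radius (fun n => Cmod (a n))) ->
  is_CPSeries a z (CPSeries a z).
Proof.
  intros Hz.
  assert (He : @ex_series C_AbsRing C_NormedModule (fun n => (a n * z ^ n)%C)).
  { apply (@ex_series_le C_AbsRing C_CompleteNormedModule _
             (fun n => Cmod (a n) * Cmod z ^ n)).
    - intros n. change (Cmod (a n * z ^ n)%C <= Cmod (a n) * Cmod z ^ n).
      rewrite Cmod_mult, Cmod_pow. lra.
    - apply ex_series_ext with (fun n => Rabs (Cmod (a n) * Cmod z ^ n)).
      + intros n. apply Rabs_pos_eq.
        apply Rmult_le_pos; [apply Cmod_ge_0|apply pow_le, Cmod_ge_0].
      + apply CV_disk_inside. rewrite Rabs_pos_eq; [exact Hz|apply Cmod_ge_0]. }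
  destruct He as [l Hl]. apply is_CPSeries_Cpow in Hl.
  now rewrite (is_CPSeries_unique _ _ _ Hl).
Qed.

(* For [n < 2] the truncated exponents are harmless: their factors vanish. *)
Lemma Cpow_taylor_le (z h : C) (rho : R) (n : nat) :
  Cmod z + Cmod h <= rho ->
  Cmod ((z + h) ^ n - z ^ n - RtoC (INR n) * z ^ (n - 1) * h)%C
  <= INR n * INR (n - 1) * rho ^ (n - 2) * Cmod h ^ 2.
Proof.
  intros Hrho.
  pose proof (Cmod_ge_0 z) as Hz. pose proof (Cmod_ge_0 h) as Hh.
  destruct n as [|[|n]].
  1, 2: simpl; rewrite ?Rmult_0_l, ?Rmult_0_r, ?Rmult_0_l;
    match goal with |- Cmod ?w <= _ => replace w with (RtoC 0) by ring end;
    rewrite Cmod_0; lra.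
  replace (S (S n) - 1)%nat with (S n) by lia.
  replace (S (S n) - 2)%nat with n by lia.
  induction n as [|n IH].
  - match goal with |- Cmod ?w <= _ => replace w with (h * h)%C by (simpl; rewrite RtoC_plus; ring) end.
    rewrite Cmod_mult. simpl. nra.
  (* The remainder for exponent N + 1 is (z + h) times the remainder for N, plus N z^(N-1) h^2.
     Since (N + 1) N = N (N - 1) + 2 N, the claimed bound even leaves one copy of N rho^(N-1) |h|^2
     to spare. *)
  - replace ((z + h) ^ S (S (S n)) - z ^ S (S (S n)) - RtoC (INR (S (S (S n)))) * z ^ S (S n) * h)%C
      with ((z + h) * ((z + h) ^ S (S n) - z ^ S (S n) - RtoC (INR (S (S n))) * z ^ S n * h)
            + RtoC (INR (S (S n))) * z ^ S n * (h * h))%C.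
    2:{ rewrite (S_INR (S (S n))), RtoC_plus. simpl. ring. }
    refine (Rle_trans _ _ _ (Cmod_triangle _ _) _).
    rewrite !Cmod_mult, Cmod_pow, Cmod_R, (Rabs_pos_eq _ (pos_INR _)).
    assert (H1 : Cmod (z + h) <= rho) by (eapply Rle_trans; [apply Cmod_triangle|lra]).
    assert (H2 : Cmod z ^ S n <= rho ^ S n) by (apply pow_incr; lra).
    assert (H3 : Cmod (z + h) * Cmod ((z + h) ^ S (S n) - z ^ S (S n) - RtoC (INR (S (S n))) * z ^ S n * h)
       <= rho * (INR (S (S n)) * INR (S n) * rho ^ n * Cmod h ^ 2)).
    { apply Rmult_le_compat; auto using Cmod_ge_0. }
    assert (H4 : INR (S (S n)) * Cmod z ^ S n * (Cmod h * Cmod h)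
      <= INR (S (S n)) * rho ^ S n * Cmod h ^ 2).
    { simpl (Cmod h ^ 2). rewrite Rmult_1_r.
      apply Rmult_le_compat_r; [nra|].
      apply Rmult_le_compat_l; [apply pos_INR|exact H2]. }
    assert (H5 : 0 <= INR (S (S n)) * rho ^ S n * Cmod h ^ 2).
    { apply Rmult_le_pos; [apply Rmult_le_pos|apply pow_le; lra].
      - apply pos_INR.
      - apply pow_le; lra. }
    rewrite (S_INR (S (S n))).
    replace ((INR (S (S n)) + 1) * INR (S (S n)) * rho ^ S n * Cmod h ^ 2)
      with (rho * (INR (S (S n)) * INR (S n) * rho ^ n * Cmod h ^ 2)
            + INR (S (S n)) * rho ^ S n * Cmod h ^ 2
            + INR (S (S n)) * rho ^ S n * Cmod h ^ 2)
      by (rewrite (S_INR (S n)); simpl (rho ^ S n); ring).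
    lra.
Qed.

(** From index 2 on these are the terms of the second formal derivative, which has the same radius
    of convergence as [b]. *)
Lemma ex_series_second_derive (b : nat -> R) (r : R) :
  Rbar_lt (Rabs r) (CV_radius b) ->
  ex_series (fun n => b n * (INR n * INR (n - 1) * r ^ (n - 2))).
Proof.
  intros Hr.
  apply (ex_series_incr_n _ 2).
  rewrite <- CV_radius_derive, <- CV_radius_derive in Hr.
  apply CV_radius_inside in Hr.
  revert Hr. apply ex_series_ext. intros n.
  rewrite pow_n_pow. change (@scal R_AbsRing R_NormedModule) with Rmult.
  unfold PS_derive. change (2 + n)%nat with (S (S n)).
  replace (S (S n) - 1)%nat with (S n) by lia.
  replace (S (S n) - 2)%nat with n by lia.
  match goal with |- ?x = ?y => change (@eq R x y) end. ring.
Qed.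

Lemma CV_radius_Cmod_derive (a : nat -> C) :
  CV_radius (fun n => Cmod (RtoC (INR (S n)) * a (S n))) =
  CV_radius (fun n => Cmod (a n)).
Proof.
  rewrite <- (CV_radius_derive (fun n => Cmod (a n))).
  apply CV_radius_ext. intros n. unfold PS_derive.
  now rewrite Cmod_mult, Cmod_R, (Rabs_pos_eq _ (pos_INR _)).
Qed.

(** For rho strictly between |z| and the radius, summing the bounds of [Cpow_taylor_le] gives a
    remainder of at most M |y - z|^2, with M the sum of |a_n| n (n - 1) rho^(n-2). A quadratic
    remainder identifies the derivative. *)
Lemma is_derive_CPSeries (a : nat -> C) (z : C) :
  Rbar_lt (Cmod z) (CV_radius (fun n => Cmod (a n))) ->
  @is_derive C_AbsRing C_NormedModule (CPSeries a) z
    (CPSeries (fun n => RtoC (INR (S n)) * a (S n))%C z).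
Proof.
  intros Hz.
  assert (Hrho : exists rho, Cmod z < rho /\
            Rbar_lt rho (CV_radius (fun n => Cmod (a n)))).
  { destruct (CV_radius (fun n => Cmod (a n))) as [x| |]; simpl in Hz |- *.
    - exists ((Cmod z + x) / 2). lra.
    - exists (Cmod z + 1). lra.
    - easy. }
  destruct Hrho as [rho [Hzr Hr]].
  pose proof (Cmod_ge_0 z) as Hz0.
  set (l := CPSeries _ z).
  assert (Hl : is_CPSeries (fun n => RtoC (INR (S n)) * a (S n))%C z l).
  { apply CPSeries_correct. now rewrite CV_radius_Cmod_derive. }
  (* The derivative series is shifted so that its term n carries [a n], to be subtracted termwise;
     the new term 0 vanishes through its factor [INR 0]. *)
  assert (Hl' : @is_series C_AbsRing C_NormedModule
                  (fun n => a n * (RtoC (INR n) * z ^ (n - 1)))%C l).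
  { apply is_series_decr_1.
    match goal with |- is_series _ ?w => replace w with l end.
    2:{ change (l = (l + - (a O * (RtoC 0 * z ^ 0)))%C). simpl. ring. }
    apply is_CPSeries_Cpow in Hl. revert Hl. apply is_series_ext. intros n.
    replace (S n - 1)%nat with n by lia.
    match goal with |- ?x = ?y => change (@eq C x y) end. ring. }
  set (b := fun n => Cmod (a n) * (INR n * INR (n - 1) * rho ^ (n - 2))).
  assert (Hb : ex_series b).
  { apply ex_series_second_derive. rewrite Rabs_pos_eq; [exact Hr|lra]. }
  assert (Hb0 : forall n, 0 <= b n).
  { intros n. repeat apply Rmult_le_pos; try apply pos_INR; [apply Cmod_ge_0|].
    apply pow_le; lra. }
  assert (HM : 0 <= Series b).
  { now apply Series_nonneg. }
  assert (Hrem : forall y, Cmod (y - z) <= rho - Cmod z ->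
    Cmod (CPSeries a y - CPSeries a z - (y - z) * l)%C <= Series b * Cmod (y - z) ^ 2).
  { intros y Hy.
    assert (Hyr : Cmod y <= rho).
    { replace y with (z + (y - z))%C by ring.
      eapply Rle_trans; [apply Cmod_triangle|]. lra. }
    assert (Sy : is_CPSeries a y (CPSeries a y)).
    { apply CPSeries_correct. eapply Rbar_le_lt_trans; [|exact Hr]. exact Hyr. }
    assert (Sz : is_CPSeries a z (CPSeries a z)) by now apply CPSeries_correct.
    apply is_CPSeries_Cpow in Sy, Sz.
    rewrite (Rmult_comm (Series b)), <- Series_scal_l.
    apply Cmod_is_series_le with
      (fun n => a n * (y ^ n - z ^ n - RtoC (INR n) * z ^ (n - 1) * (y - z)))%C.
    - intros n. rewrite Cmod_mult. unfold b.
      replace (Cmod (y - z) ^ 2 * (Cmod (a n) * (INR n * INR (n - 1) * rho ^ (n - 2))))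
        with (Cmod (a n) * (INR n * INR (n - 1) * rho ^ (n - 2) * Cmod (y - z) ^ 2)) by ring.
      apply Rmult_le_compat_l; [apply Cmod_ge_0|].
      replace y with (z + (y - z))%C at 1 by ring.
      apply Cpow_taylor_le. lra.
    - now apply (ex_series_scal_l (K := R_AbsRing) (V := R_NormedModule)).
    - pose proof (is_series_minus _ _ _ _ (is_series_minus _ _ _ _ Sy Sz)
        (is_series_scal_l (V := C_NormedModule) (y - z)%C _ _ Hl')) as HS.
      revert HS. apply is_series_ext. intros n.
      change (((a n * y ^ n + - (a n * z ^ n)) + - ((y - z) * (a n * (RtoC (INR n) * z ^ (n - 1)))))%C
        = (a n * (y ^ n - z ^ n - RtoC (INR n) * z ^ (n - 1) * (y - z)))%C).
      ring. }
  split; [apply is_linear_scal_l|].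
  intros x Hx.
  apply (@is_filter_lim_locally_unique C_AbsRing (AbsRing_NormedModule C_AbsRing)) in Hx.
  subst x. intros [eps Heps].
  (* The first bound keeps y in the disk of radius rho; the second turns M |y - z|^2 into at most
     eps |y - z|, the added 1 covering M = 0. *)
  assert (Hd : 0 < Rmin (rho - Cmod z) (eps / (Series b + 1))).
  { apply Rmin_pos; [lra|]. apply Rdiv_lt_0_compat; lra. }
  exists (mkposreal _ Hd). intros y Hy.
  change (Cmod (y - z) < Rmin (rho - Cmod z) (eps / (Series b + 1))) in Hy.
  change (Cmod ((CPSeries a y - CPSeries a z) - (y - z) * l)%C <= eps * Cmod (y - z)).
  assert (H1 : Cmod (y - z) <= rho - Cmod z)
    by (eapply Rle_trans; [apply Rlt_le, Hy|apply Rmin_l]).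
  assert (H2 : Cmod (y - z) <= eps / (Series b + 1))
    by (eapply Rle_trans; [apply Rlt_le, Hy|apply Rmin_r]).
  refine (Rle_trans _ _ _ (Hrem y H1) _).
  apply (Rmult_le_compat_l (Series b + 1)) in H2; [|lra].
  replace ((Series b + 1) * (eps / (Series b + 1))) with eps in H2 by (field; lra).
  pose proof (Cmod_ge_0 (y - z)). nra.
Qed.

(** * Functions z - sum c_n z^n with nonnegative coefficients *)

Definition times_index (c : nat -> R) (n : nat) : R := INR n * c n.

(** Equality is asked on the disk only, where the values of [zderiv] can be controlled. *)
Definition minus_series (c : nat -> R) (f : C -> C) : Prop :=
  forall z, unit_disk z -> f z = (z - CPSeries (fun n => RtoC (c n)) z)%C.

(** A radius strictly above 1 gives convergence on the closed disk and continuity of the sums at 1,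
    where the coefficient condition is read off. *)
Record admissible (c : nat -> R) : Prop := {
  adm_0 : c 0%nat = 0;
  adm_1 : c 1%nat = 0;
  adm_nonneg : forall n, 0 <= c n;
  adm_radius : Rbar_lt 1 (CV_radius c)
}.

(** [times_index c] is the formal derivative shifted up by one index, and neither operation changes
    the radius. *)
Lemma CV_radius_times_index (c : nat -> R) :
  CV_radius (times_index c) = CV_radius c.
Proof.
  rewrite <- (CV_radius_derive c), <- (CV_radius_incr_1 (PS_derive c)).
  apply CV_radius_ext. intros [|n]; unfold times_index; simpl; [|reflexivity].
  change (0 * c 0%nat = 0). ring.
Qed.

Lemma admissible_times_index (c : nat -> R) :
  admissible c -> admissible (times_index c).
Proof.
  intros [H0 H1 Hn Hr]. split.
  - unfold times_index. rewrite H0. ring.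
  - unfold times_index. rewrite H1. ring.
  - intros n. apply Rmult_le_pos; [apply pos_INR|apply Hn].
  - now rewrite CV_radius_times_index.
Qed.

Lemma CV_radius_Cmod_RtoC (c : nat -> R) :
  (forall n, 0 <= c n) ->
  CV_radius (fun n => Cmod (RtoC (c n))) = CV_radius c.
Proof.
  intros Hn. apply CV_radius_ext. intros n.
  now rewrite Cmod_R, Rabs_pos_eq.
Qed.

Lemma admissible_correct (c : nat -> R) (z : C) :
  admissible c -> Cmod z <= 1 ->
  is_CPSeries (fun n => RtoC (c n)) z (CPSeries (fun n => RtoC (c n)) z).
Proof.
  intros [_ _ Hn Hr] Hz. apply CPSeries_correct.
  rewrite CV_radius_Cmod_RtoC by exact Hn.
  eapply Rbar_le_lt_trans; [|exact Hr]. exact Hz.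
Qed.

Lemma admissible_ex_series (c : nat -> R) : admissible c -> ex_series c.
Proof.
  intros [_ _ Hn Hr].
  rewrite <- (Rabs_pos_eq 1) in Hr by lra.
  apply CV_disk_inside in Hr. revert Hr. apply ex_series_ext. intros n.
  now rewrite pow1, Rmult_1_r, Rabs_pos_eq.
Qed.

Lemma CPSeries_RtoC (c : nat -> R) (r : R) :
  admissible c -> Rabs r <= 1 ->
  CPSeries (fun n => RtoC (c n)) (RtoC r) = RtoC (PSeries c r).
Proof.
  intros [_ _ Hn Hr] Hr1. apply is_CPSeries_unique, is_CPSeries_Cpow.
  assert (H : is_pseries c r (PSeries c r)).
  { apply PSeries_correct, CV_radius_inside.
    eapply Rbar_le_lt_trans; [|exact Hr]. exact Hr1. }
  apply is_pseries_R in H.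
  assert (E : forall n, @sum_n C_NormedModule (fun n => RtoC (c n) * RtoC r ^ n)%C n
                = RtoC (sum_n (fun n => c n * r ^ n) n)).
  { induction n as [|n IH].
    - rewrite !sum_O. now rewrite <- RtoC_pow, <- RtoC_mult.
    - rewrite !sum_Sn, IH, <- RtoC_pow, <- RtoC_mult.
      symmetry. apply RtoC_plus. }
  apply (filterlim_ext (fun n => RtoC (sum_n (fun n => c n * r ^ n) n)));
    [now intros n; rewrite E|].
  (* Balls of C are products of real balls here, and both imaginary parts are 0. *)
  intros P [eps HP]. apply (H (fun x => P (RtoC x))).
  exists eps. intros y Hy. apply HP. split; [exact Hy|].
  apply ball_center.
Qed.

Lemma is_derive_minus_series (c : nat -> R) (f : C -> C) (z : C) :
  admissible c -> minus_series c f -> unit_disk z ->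
  @is_derive C_AbsRing C_NormedModule f z
    (1 - CPSeries (fun n => RtoC (INR (S n)) * RtoC (c (S n)))%C z)%C.
Proof.
  intros [_ _ Hn Hr] Hf Hz.
  (* [f] is known on the disk only, but the disk contains the ball of radius 1 - |z| around z. *)
  apply (@is_derive_ext_loc C_AbsRing C_NormedModule
           (fun w => (w - CPSeries (fun n => RtoC (c n)) w)%C)).
  - assert (Hd : 0 < 1 - Cmod z) by (unfold unit_disk in Hz; lra).
    exists (mkposreal _ Hd). intros y Hy. symmetry. apply Hf.
    change (Cmod (y - z) < 1 - Cmod z) in Hy. unfold unit_disk.
    replace y with (z + (y - z))%C by ring.
    eapply Rle_lt_trans; [apply Cmod_triangle|lra].
  - apply (@is_derive_minus C_AbsRing C_NormedModule (fun w => w)).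
    + (* Not [is_derive_id], which differentiates into
         [AbsRing_NormedModule C_AbsRing], not convertible to [C_NormedModule]. *)
      split; [apply is_linear_scal_l|].
      intros x Hx [eps Heps].
      apply (@is_filter_lim_locally_unique C_AbsRing (AbsRing_NormedModule C_AbsRing)) in Hx.
      subst x. apply filter_forall. intros y.
      change (Cmod (y - z - (y - z) * 1)%C <= eps * Cmod (y - z)).
      replace (y - z - (y - z) * 1)%C with (RtoC 0) by ring.
      rewrite Cmod_0. apply Rmult_le_pos; [lra|apply Cmod_ge_0].
    + apply is_derive_CPSeries. rewrite CV_radius_Cmod_RtoC by exact Hn.
      eapply Rbar_lt_le_trans; [|apply Rbar_lt_le, Hr]. exact Hz.
Qed.

(** Multiplying the derivative series by z shifts (n + 1) c_(n+1) to index n + 1, giving n c_n. The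
    same framework therefore applies again to [zderiv f]. *)
Lemma zderiv_minus_series (c : nat -> R) (f : C -> C) :
  admissible c -> minus_series c f -> minus_series (times_index c) (zderiv f).
Proof.
  intros Hc Hf z Hz. unfold zderiv.
  rewrite (is_C_derive_unique _ _ _ (is_derive_minus_series _ _ _ Hc Hf Hz)).
  set (l := CPSeries (fun n => RtoC (INR (S n)) * RtoC (c (S n)))%C z).
  replace (CPSeries (fun n => RtoC (times_index c n)) z) with (z * l)%C; [ring|].
  symmetry. apply is_CPSeries_unique.
  apply (@is_pseries_ext C_AbsRing C_NormedModule
    (PS_incr_1 (fun n => RtoC (INR (S n)) * RtoC (c (S n)))%C : nat -> C)).
  { intros [|n]; unfold times_index; [|symmetry; apply RtoC_mult].
    simpl. rewrite Rmult_0_l. reflexivity. }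
  apply (@is_pseries_incr_1 C_AbsRing C_NormedModule).
  apply CPSeries_correct.
  rewrite (CV_radius_Cmod_derive (fun n => RtoC (c n))).
  destruct Hc as [_ _ Hn Hr].
  rewrite CV_radius_Cmod_RtoC by exact Hn.
  eapply Rbar_lt_le_trans; [|apply Rbar_lt_le, Hr]. exact Hz.
Qed.

Lemma class_T_minus_series (c : nat -> R) (f : C -> C) :
  admissible c -> minus_series c f -> class_T f.
Proof.
  intros Hc Hf.
  assert (Hs : forall z, unit_disk z -> is_CPSeries (fun n => RtoC (c n)) z (z - f z)%C).
  { intros z Hz. rewrite (Hf z Hz).
    replace (z - (z - CPSeries (fun n => RtoC (c n)) z))%C
      with (CPSeries (fun n => RtoC (c n)) z) by ring.
    apply admissible_correct; [exact Hc|]. apply Rlt_le, Hz. }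
  destruct (Hc) as [H0 H1 Hn Hr].
  split; [split|].
  - intros z Hz. eexists. exact (is_derive_minus_series c f z Hc Hf Hz).
  - exists (fun n => (- RtoC (c n))%C). intros z Hz.
    replace (f z - z)%C with (- (z - f z))%C by ring.
    apply (@is_pseries_ext C_AbsRing C_NormedModule (fun n => (- RtoC (c n))%C)).
    { intros [|[|n]]; simpl; [rewrite H0|rewrite H1|reflexivity]; apply Copp_0. }
    apply (@is_pseries_opp C_AbsRing C_NormedModule). now apply Hs.
  - exists (fun n => RtoC (c n)). intros z Hz.
    apply (@is_pseries_ext C_AbsRing C_NormedModule (fun n => RtoC (c n)));
      [|now apply Hs].
    intros [|[|n]]; simpl; [now rewrite H0|now rewrite H1|].
    now rewrite Cmod_R, Rabs_pos_eq.
Qed.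

(* As [c 0 = c 1 = 0], each term of the series is at most [|z|^2] times its
   value at [1]. *)
Lemma Cmod_affine_le (c : nat -> R) (alpha beta : R) (z : C) :
  admissible c -> (forall n, (2 <= n)%nat -> 0 <= alpha + beta * INR n) ->
  Cmod z <= 1 ->
  Cmod (RtoC alpha * CPSeries (fun n => RtoC (c n)) z
        + RtoC beta * CPSeries (fun n => RtoC (times_index c n)) z)%C
  <= Cmod z ^ 2 * (alpha * Series c + beta * Series (times_index c)).
Proof.
  intros Hc Hab Hz.
  pose proof (admissible_times_index c Hc) as Hc'.
  pose proof (admissible_correct _ _ Hc Hz) as S0.
  pose proof (admissible_correct _ _ Hc' Hz) as S1.
  apply is_CPSeries_Cpow in S0, S1.
  pose proof (Series_correct _ (admissible_ex_series _ Hc)) as R0.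
  pose proof (Series_correct _ (admissible_ex_series _ Hc')) as R1.
  pose proof (is_series_scal_l (V := R_NormedModule) (Cmod z ^ 2) _ _
    (is_series_plus _ _ _ _
      (is_series_scal_l (V := R_NormedModule) alpha _ _ R0)
      (is_series_scal_l (V := R_NormedModule) beta _ _ R1))) as R2.
  change (is_series (fun n => Cmod z ^ 2 * (alpha * c n + beta * times_index c n))
            (Cmod z ^ 2 * (alpha * Series c + beta * Series (times_index c)))) in R2.
  rewrite <- (is_series_unique _ _ R2).
  apply Cmod_is_series_le with (fun n =>
    RtoC alpha * (RtoC (c n) * z ^ n) + RtoC beta * (RtoC (times_index c n) * z ^ n))%C.
  - intros n.
    replace (RtoC alpha * (RtoC (c n) * z ^ n) + RtoC beta * (RtoC (times_index c n) * z ^ n))%C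
      with (RtoC ((alpha + beta * INR n) * c n) * z ^ n)%C
      by (unfold times_index; rewrite !RtoC_mult, RtoC_plus, RtoC_mult; ring).
    rewrite Cmod_mult, Cmod_pow, Cmod_R.
    replace (alpha * c n + beta * times_index c n)
      with ((alpha + beta * INR n) * c n) by (unfold times_index; ring).
    destruct Hc as [H0 H1 Hn _].
    destruct n as [|[|n]].
    + rewrite H0, !Rmult_0_r, Rabs_R0. lra.
    + rewrite H1, !Rmult_0_r, Rabs_R0. lra.
    + rewrite Rabs_pos_eq by (apply Rmult_le_pos; [apply Hab; lia|apply Hn]).
      rewrite Rmult_comm. apply Rmult_le_compat_r.
      { apply Rmult_le_pos; [apply Hab; lia|apply Hn]. }
      replace (Cmod z ^ S (S n)) with (Cmod z ^ 2 * Cmod z ^ n) by (simpl; ring).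
      rewrite <- (Rmult_1_r (Cmod z ^ 2)) at 2.
      apply Rmult_le_compat_l; [apply pow2_ge_0|].
      rewrite <- (pow1 n). apply pow_incr. split; [apply Cmod_ge_0|exact Hz].
  - eexists; exact R2.
  - exact (is_series_plus _ _ _ _
      (is_series_scal_l (V := C_NormedModule) (RtoC alpha) _ _ S0)
      (is_series_scal_l (V := C_NormedModule) (RtoC beta) _ _ S1)).
Qed.

Lemma Series_times_index_ge (c : nat -> R) :
  admissible c -> 0 <= Series c <= Series (times_index c).
Proof.
  intros Hc. pose proof (admissible_ex_series _ (admissible_times_index _ Hc)) as He.
  pose proof (admissible_ex_series _ Hc) as He0.
  destruct Hc as [H0 H1 Hn Hr]. split; [now apply Series_nonneg|].
  apply Series_le; [|exact He]. intros n. split; [apply Hn|].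
  unfold times_index. destruct n as [|n]; [rewrite H0; lra|].
  rewrite S_INR. pose proof (pos_INR n). specialize (Hn (S n)). nra.
Qed.

(** * The coefficient criterion for [class_S] *)

Lemma quot_mobius (p d : C) :
  d <> RtoC 0 -> (p + d)%C <> RtoC 0 ->
  ((p / d - 1) / (p / d + 1))%C = ((p - d) / (p + d))%C.
Proof.
  intros Hd Hs. field. auto.
Qed.

Lemma Cmod_minus_ge (a b : C) : Cmod a - Cmod b <= Cmod (a - b).
Proof.
  pose proof (Cmod_triangle (a - b) b) as H.
  replace (a - b + b)%C with a in H by ring. lra.
Qed.

Lemma continuity_pt_ge0_at_1 (g : R -> R) :
  continuity_pt g 1 -> (forall r, 0 < r < 1 -> 0 < g r) -> 0 <= g 1.
Proof.
  intros Hg Hpos. destruct (Rle_or_lt 0 (g 1)) as [H|H]; [exact H|exfalso].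
  destruct (Hg (- g 1)) as [d [Hd Hcl]]; [lra|].
  (* A point of (0, 1) within d of 1, whatever the size of d. *)
  set (r := Rmax (1 / 2) (1 - d / 2)).
  assert (Hr : 0 < r < 1).
  { split; unfold r; [eapply Rlt_le_trans; [|apply Rmax_l]; lra|].
    apply Rmax_lub_lt; lra. }
  assert (Hr' : 1 - d / 2 <= r) by apply Rmax_r.
  specialize (Hpos r Hr).
  assert (Hlt : Rabs (g r - g 1) < - g 1).
  { apply (Hcl r). split; [split; [exact I|lra]|].
    change (Rabs (r - 1) < d). rewrite Rabs_left; lra. }
  rewrite Rabs_pos_eq in Hlt; lra.
Qed.

Lemma RtoC_affine (alpha beta x y : R) :
  (RtoC alpha * RtoC x + RtoC beta * RtoC y)%C = RtoC (alpha * x + beta * y).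
Proof. now rewrite RtoC_plus, !RtoC_mult. Qed.

Section Criterion.

Variables (c : nat -> R) (f : C -> C) (k lambda : R).
Hypothesis Hc : admissible c.
Hypothesis Hf : minus_series c f.
Hypothesis Hk : 0 < k.
Hypothesis Hl : 0 <= lambda < 1.

Let S0 (z : C) : C := CPSeries (fun n => RtoC (c n)) z.
Let S1 (z : C) : C := CPSeries (fun n => RtoC (times_index c n)) z.

(** The factors -1 and 1 are kept so that the bracket has the shape treated by [Cmod_affine_le] and
    [RtoC_affine]. *)
Lemma zderiv_minus_denom (z : C) : unit_disk z ->
  (zderiv f z - quot_denom lambda f z)%C
  = (- (RtoC (1 - lambda) * (RtoC (-1) * S0 z + RtoC 1 * S1 z)))%C.
Proof.
  intros Hz. unfold quot_denom.
  rewrite (zderiv_minus_series _ _ Hc Hf z Hz), (Hf z Hz).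
  fold (S0 z) (S1 z). rewrite RtoC_minus, (RtoC_opp 1 : RtoC (-1) = _). ring.
Qed.

Lemma zderiv_plus_denom (z : C) : unit_disk z ->
  (zderiv f z + quot_denom lambda f z)%C
  = (RtoC 2 * z - (RtoC (1 - lambda) * S0 z + RtoC (1 + lambda) * S1 z))%C.
Proof.
  intros Hz. unfold quot_denom.
  rewrite (zderiv_minus_series _ _ Hc Hf z Hz), (Hf z Hz).
  fold (S0 z) (S1 z). rewrite RtoC_minus, RtoC_plus. ring.
Qed.

Lemma quot_denom_eq (z : C) : unit_disk z ->
  quot_denom lambda f z = (z - (RtoC (1 - lambda) * S0 z + RtoC lambda * S1 z))%C.
Proof.
  intros Hz. unfold quot_denom.
  rewrite (zderiv_minus_series _ _ Hc Hf z Hz), (Hf z Hz).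
  fold (S0 z) (S1 z). rewrite RtoC_minus. ring.
Qed.

(** Strictness comes from the powers of |z|: the series are bounded by multiples of |z|^2, while the
    leading term 2 z has modulus 2 |z|, and |z|^2 < |z| for 0 < |z| < 1. Equality in the coefficient
    condition is therefore allowed. *)
Lemma class_S_sufficient :
  (1 - lambda) * (Series (times_index c) - Series c)
  + k * ((1 + lambda) * Series (times_index c) + (1 - lambda) * Series c) <= 2 * k ->
  class_S k lambda f.
Proof.
  intros HB. split; [now apply class_T_minus_series with c|].
  intros z Hz. pose proof (Series_times_index_ge c Hc) as HA.
  unfold quot. destruct (Ceq_dec z (RtoC 0)) as [Hz0|Hz0].
  (* At 0 the quotient is 1 by convention, so the Moebius expression is 0. *)
  - split; [intros H; contradiction|].
    assert (H2 : (1 + 1)%C <> RtoC 0).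
    { rewrite <- RtoC_plus. intros H. apply RtoC_inj in H. lra. }
    split; [exact H2|].
    replace ((1 - 1) / (1 + 1))%C with (RtoC 0) by (field; exact H2).
    now rewrite Cmod_0.
  - assert (Hr : 0 < Cmod z) by now apply Cmod_gt_0.
    assert (Hr1 : Cmod z < 1) by exact Hz.
    assert (HN : Cmod (zderiv f z - quot_denom lambda f z)
                 <= (1 - lambda) * (Cmod z ^ 2 * (-1 * Series c + 1 * Series (times_index c)))).
    { rewrite zderiv_minus_denom by exact Hz.
      rewrite Cmod_opp, Cmod_mult, Cmod_R, Rabs_pos_eq by lra.
      apply Rmult_le_compat_l; [lra|].
      apply Cmod_affine_le; [exact Hc| |lra].
      intros n Hn. apply le_INR in Hn. simpl in Hn. lra. }
    assert (HE : 2 * Cmod z - Cmod z ^ 2 * ((1 - lambda) * Series c + (1 + lambda) * Series (times_index c))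
                 <= Cmod (zderiv f z + quot_denom lambda f z)).
    { rewrite zderiv_plus_denom by exact Hz.
      eapply Rle_trans; [|apply Cmod_minus_ge].
      rewrite Cmod_mult, Cmod_R, Rabs_pos_eq by lra.
      apply Rplus_le_compat_l, Ropp_le_contravar.
      apply Cmod_affine_le; [exact Hc| |lra].
      intros n Hn. pose proof (pos_INR n). nra. }
    assert (HD : Cmod z - Cmod z ^ 2 * ((1 - lambda) * Series c + lambda * Series (times_index c))
                 <= Cmod (quot_denom lambda f z)).
    { rewrite quot_denom_eq by exact Hz.
      eapply Rle_trans; [|apply Cmod_minus_ge].
      apply Rplus_le_compat_l, Ropp_le_contravar.
      apply Cmod_affine_le; [exact Hc| |lra].
      intros n Hn. pose proof (pos_INR n). nra. }
    assert (Hsq : 0 < Cmod z ^ 2 < Cmod z) by (simpl; nra).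
    set (A0 := Series c) in *. set (A1 := Series (times_index c)) in *.
    assert (HNE : Cmod (zderiv f z - quot_denom lambda f z)
                  < k * Cmod (zderiv f z + quot_denom lambda f z)).
    { eapply Rle_lt_trans; [exact HN|].
      eapply Rlt_le_trans; [|apply Rmult_le_compat_l; [lra|exact HE]].
      nra. }
    assert (Hs : (zderiv f z + quot_denom lambda f z)%C <> RtoC 0).
    { intros H. rewrite H, Cmod_0 in HNE.
      pose proof (Cmod_ge_0 (zderiv f z - quot_denom lambda f z)). lra. }
    (* The left side of [HB] exceeds 2 k times this sum by (1 - lambda) (1 + k) (A1 - A0), which is
       nonnegative. The bound then keeps [quot_denom] away from 0. *)
    assert (Hw : (1 - lambda) * A0 + lambda * A1 <= 1).
    { apply Rmult_le_reg_l with (2 * k); [lra|].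
      assert (0 <= (1 - lambda) * (1 + k) * (A1 - A0))
        by (apply Rmult_le_pos; [apply Rmult_le_pos|]; lra).
      nra. }
    assert (Hd : quot_denom lambda f z <> RtoC 0).
    { apply Cmod_gt_0. nra. }
    split; [intros _; exact Hd|].
    split.
    + replace (zderiv f z / quot_denom lambda f z + 1)%C
        with ((zderiv f z + quot_denom lambda f z) / quot_denom lambda f z)%C
        by (field; exact Hd).
      intros H. apply Hs.
      replace (zderiv f z + quot_denom lambda f z)%C
        with (quot_denom lambda f z * ((zderiv f z + quot_denom lambda f z) / quot_denom lambda f z))%C
        by (field; exact Hd).
      rewrite H. ring.
    + rewrite quot_mobius, Cmod_div by assumption.
      apply Cmod_gt_0 in Hs.
      apply Rmult_lt_reg_r with (Cmod (zderiv f z + quot_denom lambda f z)); [exact Hs|].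
      unfold Rdiv. rewrite Rmult_assoc, Rinv_l, Rmult_1_r by lra. exact HNE.
Qed.

(** The value of [zderiv f + quot_denom lambda f] at a real point r of the disk, as a real
    number. *)
Let e (r : R) : R :=
  2 * r - ((1 - lambda) * PSeries c r + (1 + lambda) * PSeries (times_index c) r).

Lemma continuity_pt_e (r : R) : 0 <= r <= 1 -> continuity_pt e r.
Proof.
  intros Hr. destruct (Hc) as [_ _ _ Hrad].
  destruct (admissible_times_index c Hc) as [_ _ _ Hrad'].
  assert (Rabs r <= 1) by (rewrite Rabs_pos_eq; lra).
  assert (C0 : continuity_pt (PSeries c) r)
    by (apply PSeries_continuity; eapply Rbar_le_lt_trans; [|exact Hrad]; assumption).
  assert (C1 : continuity_pt (PSeries (times_index c)) r)
    by (apply PSeries_continuity; eapply Rbar_le_lt_trans; [|exact Hrad']; assumption).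
  apply continuity_pt_minus.
  - apply continuity_pt_scal, continuity_pt_id.
  - apply continuity_pt_plus; now apply continuity_pt_scal.
Qed.

(** The Moebius condition at a real point, with the denominator cleared. The sign of [e r] is still
    open, hence the absolute value. *)
Lemma class_S_real (r : R) :
  class_S k lambda f -> 0 < r < 1 ->
  e r <> 0 /\
  (1 - lambda) * (PSeries (times_index c) r - PSeries c r) < k * Rabs (e r).
Proof.
  intros [_ HS] Hr.
  assert (Hrc : Rabs r <= 1) by (rewrite Rabs_pos_eq; lra).
  assert (Hz : unit_disk (RtoC r))
    by (unfold unit_disk; rewrite Cmod_R, Rabs_pos_eq; lra).
  assert (Hz0 : RtoC r <> RtoC 0) by (intros H; apply RtoC_inj in H; lra).
  destruct (HS _ Hz) as [Hd [Hq Hlt]]. specialize (Hd Hz0).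
  unfold quot in Hq, Hlt. destruct (Ceq_dec (RtoC r) (RtoC 0)) as [H|_]; [contradiction|].
  assert (Hs : (zderiv f r + quot_denom lambda f r)%C <> RtoC 0).
  { intros H. apply Hq.
    replace (zderiv f r / quot_denom lambda f r + 1)%C
      with ((zderiv f r + quot_denom lambda f r) / quot_denom lambda f r)%C
      by (field; exact Hd).
    rewrite H. field. exact Hd. }
  rewrite quot_mobius, Cmod_div in Hlt by assumption.
  rewrite zderiv_minus_denom in Hlt by exact Hz.
  rewrite zderiv_plus_denom in Hs, Hlt by exact Hz.
  unfold S0, S1 in Hs, Hlt.
  rewrite !CPSeries_RtoC in Hs, Hlt by auto using admissible_times_index.
  rewrite (RtoC_affine (1 - lambda)) in Hs, Hlt.
  rewrite (RtoC_affine (-1)) in Hlt.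
  rewrite <- RtoC_mult, <- RtoC_minus in Hs.
  rewrite <- (RtoC_mult (1 - lambda)), <- (RtoC_mult 2), <- RtoC_minus in Hlt.
  fold (e r) in Hs, Hlt.
  rewrite Cmod_opp, !Cmod_R in Hlt.
  assert (He : e r <> 0) by (intros H; apply Hs; now rewrite H).
  split; [exact He|].
  apply Rabs_pos_lt in He.
  apply (Rmult_lt_compat_r _ _ _ He) in Hlt.
  unfold Rdiv in Hlt. rewrite Rmult_assoc, Rinv_l, Rmult_1_r in Hlt by lra.
  eapply Rle_lt_trans; [|exact Hlt].
  eapply Rle_trans; [|apply Rle_abs]. lra.
Qed.

(** A negative value at r and a positive one close to 0 would force a zero in between, which
    [class_S_real] excludes. *)
Lemma e_pos (r : R) : class_S k lambda f -> 0 < r < 1 -> 0 < e r.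
Proof.
  intros HS Hr.
  destruct (Rle_or_lt (e r) 0) as [Hneg|H]; [exfalso|exact H].
  pose proof (proj1 (class_S_real r HS Hr)) as Hne.
  set (K := (1 - lambda) * Series c + (1 + lambda) * Series (times_index c)).
  assert (HK : 0 <= K).
  { pose proof (Series_times_index_ge c Hc). unfold K. nra. }
  assert (Hlow : forall t, 0 < t < 1 -> t * (2 - t * K) <= e t).
  { intros t Ht.
    assert (Ha : Rabs t <= 1) by (rewrite Rabs_pos_eq; lra).
    pose proof (Cmod_affine_le c (1 - lambda) (1 + lambda) (RtoC t) Hc) as H.
    rewrite !CPSeries_RtoC in H by auto using admissible_times_index.
    rewrite RtoC_affine, !Cmod_R in H.
    fold K in H. rewrite pow2_abs in H.
    assert (H' : Rabs ((1 - lambda) * PSeries c t + (1 + lambda) * PSeries (times_index c) t) <= t ^ 2 * K).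
    { apply H; [|exact Ha]. intros n _. pose proof (pos_INR n). nra. }
    pose proof (Rle_abs ((1 - lambda) * PSeries c t + (1 + lambda) * PSeries (times_index c) t)).
    unfold e. simpl in H'. lra. }
  (* The first bound puts t to the left of r; the second gives t K < 1, so the lower bound t (2 - t
     K) is positive. *)
  set (t := Rmin (r / 2) (1 / (K + 1))).
  assert (Ht0 : 0 < t).
  { apply Rmin_pos; [lra|]. apply Rdiv_lt_0_compat; lra. }
  assert (Htr : t <= r / 2) by apply Rmin_l.
  assert (HtK : t * (K + 1) <= 1).
  { apply Rle_trans with (1 / (K + 1) * (K + 1)).
    - apply Rmult_le_compat_r; [lra|apply Rmin_r].
    - right. field. lra. }
  assert (Het : 0 < e t).
  { eapply Rlt_le_trans; [|apply Hlow; lra]. apply Rmult_lt_0_compat; lra. }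
  (* The intermediate value theorem is stated for a change from negative to positive, hence the sign
     flip. *)
  destruct (IVT_interv (fun x => - e x) t r) as [x [Hx Hx0]].
  - intros a Ha. apply continuity_pt_opp, continuity_pt_e. lra.
  - lra.
  - lra.
  - lra.
  - apply (proj1 (class_S_real x HS ltac:(lra))). lra.
Qed.

(** With [e] positive, the real inequality says that [g] is positive on (0, 1). Continuity at 1
    keeps the weak inequality, and there the power series become the coefficient sums. *)
Lemma class_S_necessary :
  class_S k lambda f ->
  (1 - lambda) * (Series (times_index c) - Series c)
  + k * ((1 + lambda) * Series (times_index c) + (1 - lambda) * Series c) <= 2 * k.
Proof.
  intros HS.
  assert (P1 : forall b, PSeries b 1 = Series b).
  { intros b. unfold PSeries. apply Series_ext. intros n. rewrite pow1. ring. }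
  set (g := fun r => k * e r - (1 - lambda) * (PSeries (times_index c) r - PSeries c r)).
  assert (Hg : 0 <= g 1).
  { apply continuity_pt_ge0_at_1.
    - destruct (Hc) as [_ _ _ Hrad].
      destruct (admissible_times_index c Hc) as [_ _ _ Hrad'].
      rewrite <- (Rabs_pos_eq 1) in Hrad, Hrad' by lra.
      apply continuity_pt_minus.
      + apply continuity_pt_scal, continuity_pt_e. lra.
      + apply continuity_pt_scal, continuity_pt_minus; now apply PSeries_continuity.
    - intros r Hr. destruct (class_S_real r HS Hr) as [_ H].
      pose proof (e_pos r HS Hr) as He. rewrite Rabs_pos_eq in H by lra.
      unfold g. lra. }
  unfold g, e in Hg. rewrite !P1 in Hg. lra.
Qed.

End Criterion.

Lemma class_S_iff (c : nat -> R) (f : C -> C) (k lambda : R) :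
  admissible c -> minus_series c f -> 0 < k -> 0 <= lambda < 1 ->
  class_S k lambda f <->
  (1 - lambda) * (Series (times_index c) - Series c)
  + k * ((1 + lambda) * Series (times_index c) + (1 - lambda) * Series c) <= 2 * k.
Proof.
  intros Hc Hf Hk Hl.
  split; [now apply class_S_necessary|now apply class_S_sufficient].
Qed.

(** * Poisson weights and their moments *)

(** The mass at j of the Poisson distribution of mean m; in [poisson_F m] the mass at n - 1 is
    subtracted at z^n. *)
Definition poisson (m : R) (j : nat) : R := m ^ j / INR (Factorial.fact j) * exp (- m).

Lemma poisson_S (m : R) (j : nat) :
  INR (S j) * poisson m (S j) = m * poisson m j.
Proof.
  unfold poisson. rewrite fact_simpl, mult_INR. simpl (m ^ S j).
  field. split; [apply INR_fact_neq_0|apply not_0_INR; lia].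
Qed.

Lemma is_series_poisson (m : R) : is_series (poisson m) 1.
Proof.
  pose proof (is_exp_Reals m) as H. apply is_pseries_R in H.
  apply (is_series_scal_l (V := R_NormedModule) (exp (- m))) in H.
  change (@scal R_AbsRing R_NormedModule) with Rmult in H.
  replace (exp (- m) * exp m) with 1 in H
    by (rewrite <- exp_plus, Rplus_opp_l, exp_0; reflexivity).
  revert H. apply is_series_ext. intros n.
  match goal with |- ?x = ?y => change (@eq R x y) end.
  unfold poisson, Rdiv. ring.
Qed.

(** The Poisson identity E[j w(j - 1)] = m E[w(j)], by an index shift and [poisson_S]. Taking w = 1
    and then w(j) = j yields the first two factorial moments m and m^2. *)
Lemma is_series_times_index_poisson (m l : R) (w : nat -> R) :
  is_series (fun j => w j * poisson m j) l ->
  is_series (fun j => INR j * w (j - 1)%nat * poisson m j) (m * l).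
Proof.
  intros H. apply (is_series_scal_l (V := R_NormedModule) m) in H.
  apply is_series_decr_1.
  match goal with |- is_series _ ?x => replace x with (m * l) end.
  (* The term at j = 0 vanishes, so the truncated index 0 - 1 is harmless. *)
  2:{ change (m * l = m * l + - (0 * w (0 - 1)%nat * poisson m 0)). ring. }
  revert H. apply is_series_ext. intros j.
  change (m * (w j * poisson m j) = INR (S j) * w (S j - 1)%nat * poisson m (S j)).
  replace (S j - 1)%nat with j by lia.
  transitivity (w j * (INR (S j) * poisson m (S j))); [rewrite poisson_S|]; ring.
Qed.

Lemma is_series_poisson_mean (m : R) :
  is_series (fun j => INR j * poisson m j) m.
Proof.
  pattern m at 2. rewrite <- Rmult_1_r.
  apply (is_series_ext (fun j => INR j * 1 * poisson m j)).
  { intros j. now rewrite Rmult_1_r. }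
  apply (is_series_times_index_poisson m 1 (fun _ => 1)).
  apply (is_series_ext (poisson m)); [|apply is_series_poisson].
  intros j. now rewrite Rmult_1_l.
Qed.

Lemma is_series_poisson_factorial_moment (m : R) :
  is_series (fun j => INR j * INR (j - 1) * poisson m j) (m * m).
Proof. apply is_series_times_index_poisson, is_series_poisson_mean. Qed.

(** Ratio test: consecutive masses have quotient m / (j + 1), which tends to 0. *)
Lemma CV_radius_poisson (m : R) : 0 < m -> CV_radius (poisson m) = p_infty.
Proof.
  intros Hm.
  assert (Hp : forall j, 0 < poisson m j).
  { intros j. apply Rmult_lt_0_compat; [|apply exp_pos].
    apply Rdiv_lt_0_compat; [now apply pow_lt|apply INR_fact_lt_0]. }
  apply CV_radius_infinite_DAlembert.
  - intros j. apply Rgt_not_eq, Hp.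
  - apply is_lim_seq_ext with (fun j => m * / INR (S j)).
    + intros j. assert (HS : 0 < INR (S j)) by (apply lt_0_INR; lia).
      replace (poisson m (S j)) with (m * poisson m j / INR (S j))
        by (rewrite <- poisson_S; field; lra).
      specialize (Hp j).
      replace (m * poisson m j / INR (S j) / poisson m j) with (m * / INR (S j))
        by (field; lra).
      symmetry. apply Rabs_pos_eq, Rmult_le_pos; [lra|].
      apply Rlt_le, Rinv_0_lt_compat, HS.
    + replace (Finite 0) with (Rbar_mult m (Rbar_inv p_infty))
        by (simpl; now rewrite Rmult_0_r).
      apply is_lim_seq_scal_l. apply is_lim_seq_inv; [|easy].
      apply (is_lim_seq_incr_1 INR), is_lim_seq_INR.
Qed.

(** Matching on n builds in the truncation of [from2] and resolves the index n - 1. *)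
Definition poisson_coeff (m : R) (n : nat) : R :=
  match n with
  | S (S j) => poisson m (S j)
  | _ => 0
  end.

Lemma admissible_poisson_coeff (m : R) : 0 < m -> admissible (poisson_coeff m).
Proof.
  intros Hm. split; try reflexivity.
  - intros [|[|n]]; simpl; try lra. unfold poisson.
    apply Rmult_le_pos; [|apply Rlt_le, exp_pos].
    apply Rlt_le, Rdiv_lt_0_compat; [now apply pow_lt|apply INR_fact_lt_0].
  (* The mass at 0 is dropped and two zeros are put in front; shifts preserve the radius. *)
  - rewrite (CV_radius_ext _ (PS_incr_1 (PS_incr_1 (PS_decr_1 (poisson m)))))
      by now intros [|[|n]].
    now rewrite !CV_radius_incr_1, CV_radius_decr_1, CV_radius_poisson.
Qed.

(** Passes from moments over all j to coefficient sums over n = j + 1 >= 2: only the term at j = 0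
    is lost. *)
Lemma is_series_drop_2 (a b : nat -> R) (l : R) :
  a 0%nat = 0 -> a 1%nat = 0 -> (forall j, a (S (S j)) = b (S j)) ->
  is_series b l -> is_series a (l - b 0%nat).
Proof.
  intros H0 H1 H2 Hb.
  apply (is_series_decr_n _ 2); [lia|].
  match goal with |- is_series _ ?x => replace x with (l - b 0%nat) end.
  2:{ change (l - b 0%nat = l - b 0%nat + - (sum_n a 1)).
      rewrite sum_Sn, sum_O, H0, H1. change plus with Rplus. ring. }
  apply (is_series_ext (fun j => b (S j))); [intros j; symmetry; apply H2|].
  apply is_series_incr_1.
  match goal with |- is_series _ ?x => replace x with l; [exact Hb|] end.
  change (l = l - b 0%nat + b 0%nat). ring.
Qed.

Lemma poisson_0 (m : R) : poisson m 0 = exp (- m).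
Proof. unfold poisson. simpl. field. Qed.

(** With n = j + 1 the weight n is j + 1: the mean m plus the total mass 1, less the term exp(-m) at
    j = 0. *)
Lemma Series_times_index_poisson_coeff (m : R) :
  Series (times_index (poisson_coeff m)) = m + 1 - exp (- m).
Proof.
  apply is_series_unique.
  pose proof (is_series_plus _ _ _ _ (is_series_poisson_mean m) (is_series_poisson m)) as H.
  apply (is_series_drop_2 (times_index (poisson_coeff m))) in H.
  - change (is_series (times_index (poisson_coeff m))
      (m + 1 - (INR 0 * poisson m 0 + poisson m 0))) in H.
    rewrite poisson_0 in H. simpl INR in H.
    now replace (m + 1 - (0 * exp (- m) + exp (- m))) with (m + 1 - exp (- m)) in H by ring.
  - unfold times_index. simpl. ring.
  - unfold times_index. simpl. ring.
  - intros j. change (INR (S (S j)) * poisson m (S j)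
      = INR (S j) * poisson m (S j) + poisson m (S j)).
    rewrite (S_INR (S j)). ring.
Qed.

(** The weight (j + 1)^2 equals j (j - 1) + 3 j + 1, which brings in the factorial moments m^2, m
    and 1; the term at j = 0 is again exp(-m). *)
Lemma Series_times_index2_poisson_coeff (m : R) :
  Series (times_index (times_index (poisson_coeff m)))
  = m * m + 3 * m + 1 - exp (- m).
Proof.
  apply is_series_unique.
  pose proof (is_series_plus _ _ _ _ (is_series_poisson_factorial_moment m)
    (is_series_plus _ _ _ _
       (is_series_scal_l (V := R_NormedModule) 3 _ _ (is_series_poisson_mean m))
       (is_series_poisson m))) as H.
  apply (is_series_drop_2 (times_index (times_index (poisson_coeff m)))) in H.
  - change (is_series (times_index (times_index (poisson_coeff m)))
      (m * m + (3 * m + 1) - (INR 0 * INR 0 * poisson m 0 + (3 * (INR 0 * poisson m 0) + poisson m 0)))) in H.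
    rewrite poisson_0 in H. simpl INR in H.
    match type of H with is_series _ ?x =>
      replace x with (m * m + 3 * m + 1 - exp (- m)) in H by ring end.
    exact H.
  - unfold times_index. simpl. ring.
  - unfold times_index. simpl. ring.
  - intros j. change (INR (S (S j)) * (INR (S (S j)) * poisson m (S j))
      = INR (S j) * INR (S j - 1) * poisson m (S j)
        + (3 * (INR (S j) * poisson m (S j)) + poisson m (S j))).
    replace (S j - 1)%nat with j by lia.
    rewrite !S_INR. ring.
Qed.

(** * Membership of [poisson_F] in [class_C] *)

Lemma minus_series_poisson_F (m : R) : 0 < m ->
  minus_series (poisson_coeff m) (poisson_F m).
Proof.
  intros Hm z Hz. unfold poisson_F. apply (f_equal (fun w => z - w)%C).
  apply is_CPSeries_unique.
  apply (@is_pseries_ext C_AbsRing C_NormedModule (fun n => RtoC (poisson_coeff m n))).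
  - now intros [|[|n]].
  - apply admissible_correct; [now apply admissible_poisson_coeff|].
    apply Rlt_le, Hz.
Qed.

Theorem theorem2p2 (m k lambda : R)
    (hm : (0 < m)%R) (hk : (0 < k <= 1)%R) (hlambda : (0 <= lambda < 1)%R) :
  class_C k lambda (poisson_F m) <->
  (((1 - lambda) + k * (1 + lambda)) * m ^ 2 * exp m
     + 2 * (1 + 2 * k + k * lambda - lambda) * m * exp m <= 2 * k)%R.
Proof.
  pose proof (admissible_poisson_coeff m hm) as Hc.
  pose proof (minus_series_poisson_F m hm) as Hf.
  assert (HT : class_T (poisson_F m)) by exact (class_T_minus_series _ _ Hc Hf).
  (* The criterion is applied to [zderiv (poisson_F m)], so its two sums carry the weights n and
     n^2. *)
  assert (HS := class_S_iff _ _ k lambda (admissible_times_index _ Hc)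
                 (zderiv_minus_series _ _ Hc Hf) (proj1 hk) hlambda).
  rewrite Series_times_index_poisson_coeff, Series_times_index2_poisson_coeff in HS.
  assert (Hexp : exp m * exp (- m) = 1)
    by (rewrite <- exp_plus, Rplus_opp_r; apply exp_0).
  pose proof (exp_pos m) as Hpos.
  set (B := ((1 - lambda) + k * (1 + lambda)) * m ^ 2
            + 2 * (1 + 2 * k + k * lambda - lambda) * m).
  match goal with |- _ <-> ?l <= _ => replace l with (exp m * B) by (unfold B; ring) end.
  (* The criterion becomes B <= 2 k exp(-m); multiplication by exp(m) > 0 gives the stated
     inequality. *)
  match type of HS with _ <-> ?l <= _ =>
    replace l with (B + 2 * k - 2 * k * exp (- m)) in HS by (unfold B; ring) end.
  unfold class_C. rewrite HS.
  transitivity (exp m * B <= exp m * (2 * k * exp (- m))).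
  - split.
    + intros [_ H]. apply Rmult_le_compat_l; lra.
    + intros H. apply Rmult_le_reg_l in H; [|lra]. split; [exact HT|lra].
  - replace (exp m * (2 * k * exp (- m))) with (2 * k)
      by (transitivity (2 * k * (exp m * exp (- m))); [rewrite Hexp|]; ring).
    reflexivity.
Qed.
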